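(* Let $n\in\mathbb{N}$ and let $E_1,\ldots,E_n,F$ be Banach spaces over $\mathbb{K}$. Let $\mathcal{H}(E_1,\ldots,E_n;F)$ be a linear subspace of $\mathcal{L}(E_1,\ldots,E_n;F)$ endowed with a complete norm $\|\cdot\|_{\mathcal{H}}$, containing the $n$-linear operators of finite rank and such that $\|A\otimes y\|_{\mathcal{H}}\leq \|A\|\cdot\|y\|$ for all $A\in\mathcal{L}(E_1,\ldots,E_n)$ and $y\in F$. Then: (a) The map $$\mathcal{B}_n\colon (\mathcal{H}(E_1,\ldots,E_n;F),\|\cdot\|_{\mathcal{H}})^*\longrightarrow \mathcal{L}(\mathcal{L}(E_1,\ldots,E_n);F^* ),\quad \mathcal{B}_n(\phi)(A)(y)=\phi(A\otimes y),$$ is a well defined continuous linear operator and $\|\mathcal{B}_n\|\leq 1$. (b) $\mathcal{B}_n$ is injective if and only if the subspace of finite rank operators is $\|\cdot\|_{\mathcal{H}}$-dense in $\mathcal{H}(E_1,\ldots,E_n;F)$.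
   Context: $\mathbb{K}=\mathbb{R}$ or $\mathbb{C}$. $\mathcal{L}(E_1,\ldots,E_n;F)$ is the Banach space of continuous $n$-linear operators $E_1\times\cdots\times E_n\to F$ with the usual operator norm $\|\cdot\|$; $\mathcal{L}(E_1,\ldots,E_n)$ denotes the case $F=\mathbb{K}$. $\mathcal{L}(X;Y)$ is the Banach space of bounded linear operators and $X^*$ is the topological dual of $X$. For $A\in\mathcal{L}(E_1,\ldots,E_n)$ and $y\in F$, $A\otimes y\in\mathcal{L}(E_1,\ldots,E_n;F)$ is given by $(A\otimes y)(x_1,\ldots,x_n)=A(x_1,\ldots,x_n)y$. An $n$-linear operator has finite rank if its range generates a finite dimensional subspace of $F$; the finite rank operators are exactly the finite linear combinations of operators $A\otimes y$. *)

(* Defs.v *)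
From HB Require Import structures.
From mathcomp Require Import all_boot all_order all_algebra.
From mathcomp Require Import all_classical all_reals all_analysis.
From mathcomp Require Import complex.

Set Implicit Arguments.
Unset Strict Implicit.
Unset Printing Implicit Defensive.

Import Order.TTheory GRing.Theory Num.Theory.
Import numFieldNormedType.Exports.

Local Open Scope classical_set_scope.
Local Open Scope ring_scope.

Variant scalars := real_scalars | complex_scalars.

Definition scalar_field (R : realType) (k : scalars) : numFieldType :=
  match k with
  | real_scalars => R
  | complex_scalars => complex R
  end.

(* In `complex R`, `x <= y` means that `y - x` is a nonnegative real, so that
   norms, which take their values in the scalar field, have the expected
   suprema. *)
Lemma scalar_supremums (R : realType) (k : scalars)
    (A : set (scalar_field R k)) :
  A !=set0 -> (forall a, A a -> 0 <= a) -> has_ubound A -> supremums A !=set0.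
Proof.
case: k A => /= A [a Aa] A0 [M ubM].
  have hA : has_sup A by split; [exists a | exists M].
  exists (sup A); split; first exact: sup_upper_bound.
  by move=> y uby; apply: ge_sup => //; exists a.
have aE x : A x -> x = (complex.Re x)%:C%C.
  by move=> /A0; case: x => x y; rewrite lecE /= => /andP[/eqP-> _].
have AR r x : A x -> (x <= r%:C%C) = (complex.Re x <= r).
  by move=> /aE ->; rewrite lecR.
pose B := [set complex.Re x | x in A].
have B0 : B !=set0 by exists (complex.Re a), a.
have hB : has_sup B.
  split=> //; exists (complex.Re M) => _ [x Ax <-].
  by have := ubM _ Ax; rewrite lecE => /andP[].
exists (sup B)%:C%C; split.
  by move=> x Ax; rewrite AR//; apply: sup_upper_bound => //; exists x.
move=> [y z] uby; have := uby _ Aa; rewrite (aE _ Aa) lecE /= => /andP[/eqP-> _].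
rewrite lecR; apply: ge_sup => // _ [x Ax <-].
by have := uby _ Ax; rewrite lecE => /andP[].
Qed.

Section opnorm.
Context (K : numFieldType) (T : Type) (F : normedModType K).

(* `B` is the closed unit ball of the domain. *)
Definition opnorm (B : set T) (f : T -> F) : K :=
  supremum 0 [set `|f x| | x in B].

End opnorm.

Section opnorm_theory.
Context (R : realType) (k : scalars).
Local Notation K := (scalar_field R k).
Context (T : Type) (F : normedModType K) (B : set T).
Hypothesis B0 : B !=set0.
Implicit Types f g : T -> F.

Definition bounded_on f := exists M, forall x, B x -> `|f x| <= M.

Lemma opnorm_supremums f : bounded_on f ->
  supremums [set `|f x| | x in B] !=set0.
Proof.
move: B0 => [x0 Bx0] [M fM]; apply: scalar_supremums.
- by exists `|f x0|, x0.
- by move=> _ [x _ <-].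
- by exists M => _ [x Bx <-]; exact: fM.
Qed.

Lemma opnormP f : bounded_on f ->
  supremums [set `|f x| | x in B] (opnorm B f).
Proof.
move: B0 => [x0 Bx0] /opnorm_supremums [s ss].
rewrite /opnorm /supremum; case: ifPn => [/eqP E|_].
  have : [set `|f x| | x in B] `|f x0| by exists x0.
  by rewrite E.
by case: xgetP => [y _ //|/(_ s)/(_ ss)].
Qed.

Lemma opnorm_ub f x : bounded_on f -> B x -> `|f x| <= opnorm B f.
Proof. by move=> /opnormP[ub _] Bx; apply: ub; exists x. Qed.

Lemma opnorm_le f M : bounded_on f -> (forall x, B x -> `|f x| <= M) ->
  opnorm B f <= M.
Proof.
by move=> /opnormP[_ lub] fM; apply: lub => _ [x Bx <-]; exact: fM.
Qed.

Lemma opnorm_ge0 f : bounded_on f -> 0 <= opnorm B f.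
Proof.
by move: B0 => [x0 Bx0] bf; apply: le_trans (opnorm_ub bf Bx0).
Qed.

Lemma bounded_onD f g : bounded_on f -> bounded_on g -> bounded_on (f + g).
Proof.
move=> [M fM] [N gN]; exists (M + N) => x Bx.
by rewrite (le_trans (ler_normD _ _))// lerD ?fM ?gN.
Qed.

Lemma bounded_onZ a f : bounded_on f -> bounded_on (a *: f).
Proof.
by move=> [M fM]; exists (`|a| * M) => x Bx; rewrite normrZ ler_wpM2l ?fM.
Qed.

Lemma opnormD f g : bounded_on f -> bounded_on g ->
  opnorm B (f + g) <= opnorm B f + opnorm B g.
Proof.
move=> bf bg; apply: opnorm_le => [|x Bx]; first exact: bounded_onD.
by rewrite (le_trans (ler_normD _ _))// lerD ?opnorm_ub.
Qed.

Lemma opnormZ a f : bounded_on f -> opnorm B (a *: f) = `|a| * opnorm B f.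
Proof.
have leZ b g : bounded_on g -> opnorm B (b *: g) <= `|b| * opnorm B g.
  move=> bg; apply: opnorm_le => [|x Bx]; first exact: bounded_onZ.
  by rewrite normrZ ler_wpM2l// opnorm_ub.
move=> bf; apply/le_anti; rewrite leZ//=.
have [->|a0] := eqVneq a 0.
  by rewrite normr0 mul0r opnorm_ge0//; exact: bounded_onZ.
rewrite -ler_pdivlMl ?normr_gt0// -normfV.
by rewrite -{1}[f](scalerK a0) leZ//; exact: bounded_onZ.
Qed.

Lemma opnorm_eq0 f x : bounded_on f -> opnorm B f = 0 -> B x -> f x = 0.
Proof.
by move=> bf f0 /(opnorm_ub bf); rewrite f0 normr_le0 => /eqP.
Qed.

End opnorm_theory.

Section clin.
Context (K : numFieldType) (X Y : normedModType K).

Definition is_clin : {pred X -> Y} :=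
  fun f => `[< linear f /\ continuous f >].

Record clin := Clin { clin_fun :> X -> Y; clinP : clin_fun \in is_clin }.

HB.instance Definition _ := [isSub for clin_fun].
HB.instance Definition _ := [Choice of clin by <:].

Lemma clin_submod_closed : submod_closed is_clin.
Proof.
split=> [|a f g /asboolP[fl fc] /asboolP[gl gc]]; apply/asboolP; split.
- by move=> b u v; rewrite /= scaler0 addr0.
- by move=> x; exact: cvg_cst.
- move=> b u v; rewrite -[LHS]/(a *: f (b *: u + v) + g (b *: u + v)) fl gl.
  rewrite -[RHS]/(b *: (a *: f u + g u) + (a *: f v + g v)) /=.
  by rewrite !scalerDr !scalerA (mulrC a) addrACA.
- by move=> x; apply: cvgD; [apply: cvgZr; exact: fc|exact: gc].
Qed.
HB.instance Definition _ :=
  GRing.isSubmodClosed.Build K (X -> Y) is_clin clin_submod_closed.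
HB.instance Definition _ := [SubChoice_isSubLmodule of clin by <:].

End clin.

HB.instance Definition _ (K : numFieldType) (X Y : normedModType K)
    (f : clin X Y) :=
  GRing.isLinear.Build K X Y *:%R (f : X -> Y) (proj1 (asboolW (clinP f))).

Section clin_norm.
Context (R : realType) (k : scalars).
Local Notation K := (scalar_field R k).
Context (X Y : normedModType K).
Implicit Types f : clin X Y.

Definition clin_norm f : K := opnorm [set x : X | `|x| <= 1] f.

Let ball0 : [set x : X | `|x| <= 1] !=set0.
Proof. by exists 0; rewrite /= normr0. Qed.

Lemma clin_continuous f : continuous f.
Proof. by have /asboolP[] := clinP f. Qed.

Lemma clin_bounded f : bounded_on [set x : X | `|x| <= 1] f.
Proof.
have /linear_bounded_continuous/linear_boundedP := @clin_continuous f.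
move=> /pinfty_ex_gt0[M M0 fM]; exists M => x /= x1.
by rewrite (le_trans (fM x))// ler_piMr// ltW.
Qed.

Let clin_normD f g : clin_norm (f + g) <= clin_norm f + clin_norm g.
Proof. by apply: opnormD => //; exact: clin_bounded. Qed.

Let clin_normZ (a : K) f : clin_norm (a *: f) = `|a| * clin_norm f.
Proof. by apply: opnormZ => //; exact: clin_bounded. Qed.

Let clin_norm_eq0 f : clin_norm f = 0 -> f = 0.
Proof.
move=> f0; apply/val_inj/funext => x; rewrite -[RHS]/(0 : Y).
have [->|x0] := eqVneq x 0; first exact: (linear0 f).
have := opnorm_eq0 ball0 (@clin_bounded f) f0 (x := `|x|^-1 *: x).
rewrite /= normfZV// lexx => /(_ isT)/eqP.
by rewrite linearZ /= scaler_eq0 invr_eq0 normr_eq0 (negPf x0) => /eqP.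
Qed.

HB.instance Definition _ :=
  Lmodule_isNormed.Build K (clin X Y) clin_normD clin_normZ clin_norm_eq0.

End clin_norm.

Definition dual (K : numFieldType) (X : normedModType K) := clin X K^o.

Section mlin.
Context (K : numFieldType) (n : nat).
Context (E : 'I_n -> normedModType K) (F : normedModType K).

(* `dfwith x i y` is the tuple `x` with its `i`-th entry replaced by `y : E i`. *)
Definition multilinear (f : prod_topology E -> F) :=
  forall (i : 'I_n) (x : prod_topology E), linear (fun y : E i => f (dfwith x i y)).

Definition is_mlin : {pred prod_topology E -> F} :=
  fun f => `[< multilinear f /\ continuous f >].

Record mlin := Mlin { mlin_fun :> prod_topology E -> F;
                      mlinP : mlin_fun \in is_mlin }.

HB.instance Definition _ := [isSub for mlin_fun].
HB.instance Definition _ := [Choice of mlin by <:].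

Lemma mlin_submod_closed : submod_closed is_mlin.
Proof.
split=> [|a f g /asboolP[fl fc] /asboolP[gl gc]]; apply/asboolP; split.
- by move=> i x b u v; rewrite -[LHS]/(0 : F) -[RHS]/(b *: 0 + 0) scaler0 addr0.
- by move=> x; have FF := nbhs_filter x; exact: (@cvg_cst _ (0 : F)).

- move=> i x b u v.
  rewrite -[LHS]/(a *: f (dfwith x i (b *: u + v)) + g (dfwith x i (b *: u + v))).
  rewrite fl gl.
  rewrite -[RHS]/(b *: (a *: f (dfwith x i u) + g (dfwith x i u)) +
                  (a *: f (dfwith x i v) + g (dfwith x i v))) /=.
  by rewrite !scalerDr !scalerA (mulrC a) addrACA.
- move=> x; have FF := nbhs_filter x.
  by apply: cvgD; [apply: cvgZr; exact: fc|exact: gc].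
Qed.
HB.instance Definition _ :=
  GRing.isSubmodClosed.Build K (prod_topology E -> F) is_mlin mlin_submod_closed.
HB.instance Definition _ := [SubChoice_isSubLmodule of mlin by <:].

Lemma mlin_multilinear (f : mlin) : multilinear f.
Proof. by have /asboolP[] := mlinP f. Qed.

Lemma mlin_continuous (f : mlin) : continuous f.
Proof. by have /asboolP[] := mlinP f. Qed.

Lemma mlin_dfwithZ (f : mlin) i x a (y : E i) :
  f (dfwith x i (a *: y)) = a *: f (dfwith x i y).
Proof.
have flin := @mlin_multilinear f i x.
have f0 : f (dfwith x i (0 : E i)) = 0.
  have := flin (-1) 0 0; rewrite scaler0 addr0 => {1}->.
  by rewrite scaleN1r addNr.
by have := flin a y 0; rewrite !addr0 f0 addr0.
Qed.

Lemma mlinZ (f : mlin) (c : 'I_n -> K) (x : prod_topology E) :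
  f (fun i => c i *: x i) = (\prod_i c i) *: f x.
Proof.
have gen (s : seq 'I_n) : uniq s ->
    f (fun i => if i \in s then c i *: x i else x i) = (\prod_(i <- s) c i) *: f x.
  elim: s => [_|j s IH /= /andP[js us]].
    by rewrite big_nil scale1r; congr (f _); apply: functional_extensionality_dep.
  set z := fun i => if i \in s then c i *: x i else x i.
  rewrite big_cons -scalerA -IH//.
  transitivity (f (dfwith z j (c j *: x j))).
    congr (f _); apply: functional_extensionality_dep => i.
    case: dfwithP => [|i' ji]; first by rewrite mem_head.
    by rewrite in_cons eq_sym (negPf ji).
  rewrite mlin_dfwithZ; congr (_ *: f _).
  apply: functional_extensionality_dep => i.
  by case: dfwithP => //; rewrite /z (negPf js).
rewrite -gen ?index_enum_uniq//; congr (f _).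
by apply: functional_extensionality_dep => i; rewrite mem_index_enum.
Qed.

(* Boxes form a filter base which is at least as fine as the neighborhoods of
   the origin. *)
Lemma nbhs0_box (A : set (prod_topology E)) :
  nbhs ((fun i => 0 : E i) : prod_topology E) A ->
  exists2 d : K, 0 < d & forall x, (forall i, `|x i| < d) -> A x.
Proof.
pose G : set_system (prod_topology E) :=
  [set A | exists2 d : K, 0 < d & forall x, (forall i, `|x i| < d) -> A x].
have FG : Filter G.
  split.
  - by exists 1.
  - move=> P Q [d d0 dP] [e e0 eQ]; exists (Num.min d e).
      by rewrite /Order.min; case: (d < e).
    have de : d >=< e by rewrite real_comparable// gtr0_real.
    move=> x xde; split; [apply: dP|apply: eQ] => i;
      by have := xde i; rewrite comparable_lt_min// => /andP[].
  - by move=> P Q PQ [d d0 dP]; exists d => // x /dP /PQ.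
suff GE : G --> ((fun i => 0 : E i) : prod_topology E) by exact: (GE A).
apply/cvg_sup => i P /= [_ [[B Bop <-] B0 BP]].
have /nbhs_norm0P[d /= d0 dB] : nbhs (0 : E i) B by exact: open_nbhs_nbhs.
by exists d => // x xd; apply: BP; apply: dB => /=; exact: xd.
Qed.

End mlin.

Section mlin_norm.
Context (R : realType) (k : scalars) (n : nat).
Local Notation K := (scalar_field R k).
Context (E : 'I_n -> normedModType K) (F : normedModType K).
Implicit Types f : mlin E F.

Definition mlin_norm f : K := opnorm [set x | forall i, `|x i| <= 1] f.

Local Notation U := [set x : prod_topology E | forall i, `|x i| <= 1].

Let U0 : U !=set0.
Proof. by exists (fun i => 0) => i /=; rewrite normr0. Qed.

Lemma mlin_bounded f : bounded_on U f.
Proof.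
pose f0 := f (fun=> 0).
have /nbhs0_box [d d0 fd] :
    nbhs ((fun i => 0 : E i) : prod_topology E) (f @^-1` [set y | `|f0 - y| < 1]).
  apply: (@mlin_continuous _ _ _ _ f (fun=> 0)).
  by apply/nbhs_normP; exists 1 => /=.
have d2 : 0 < d / 2 by rewrite divr_gt0.
pose D : K := \prod_(i < n) (d / 2).
have D0 : 0 < D by apply: prodr_gt0.
exists (D^-1 * (1 + `|f0|)) => x x1.
rewrite ler_pdivlMl// -[X in X * _]gtr0_norm// -normrZ -mlinZ.
set y := f _.
have : `|f0 - y| < 1.
  apply: fd => i; rewrite normrZ gtr0_norm// (le_lt_trans (ler_piMr _ (x1 i)))//.
    exact: ltW.
  by rewrite ltr_pdivrMr// ltr_pMr// ltr1n.
move=> /ltW fy; rewrite -[y](subKr f0).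
by rewrite (le_trans (ler_normB _ _))// addrC lerD.
Qed.

Let mlin_normD f g : mlin_norm (f + g) <= mlin_norm f + mlin_norm g.
Proof. by apply: opnormD => //; exact: mlin_bounded. Qed.

Let mlin_normZ (a : K) f : mlin_norm (a *: f) = `|a| * mlin_norm f.
Proof. by apply: opnormZ => //; exact: mlin_bounded. Qed.

Let mlin_norm_eq0 f : mlin_norm f = 0 -> f = 0.
Proof.
move=> f0; apply/val_inj/funext => x; rewrite -[RHS]/(0 : F).
pose c i : K := if x i == 0 then 1 else `|x i|^-1.
have c0 i : c i != 0.
  by rewrite /c; case: ifPn; rewrite ?oner_eq0// invr_eq0 normr_eq0.
have Ux : U (fun i => c i *: x i).
  move=> i; rewrite /c; case: ifPn => [/eqP->|xi0].
    by rewrite scaler0 normr0.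
  by rewrite normfZV.
have := opnorm_eq0 U0 (@mlin_bounded f) f0 Ux.
rewrite mlinZ => /eqP; rewrite scaler_eq0 => /orP[|/eqP//].
by rewrite prodf_seq_eq0 => /hasP[i _]; rewrite (negPf (c0 i)) andbF.
Qed.

HB.instance Definition _ :=
  Lmodule_isNormed.Build K (mlin E F) mlin_normD mlin_normZ mlin_norm_eq0.

End mlin_norm.

(* The range of a multilinear map is not a subspace in general, hence the span
   below. *)

Definition span_set (K : numFieldType) (V : lmodType K) (A : set V) : set V :=
  [set v | exists m (c : 'I_m -> K) (a : 'I_m -> V),
     (forall i, A (a i)) /\ v = \sum_i c i *: a i].

Definition finite_dim_set (K : numFieldType) (V : lmodType K) (A : set V) :=
  exists m (b : 'I_m -> V), A = span_set (range b).

Definition finite_rank (K : numFieldType) (n : nat) (E : 'I_n -> normedModType K)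
    (F : normedModType K) (f : mlin E F) :=
  finite_dim_set (span_set (range f)).

Section tensor.
Context (K : numFieldType) (n : nat).
Context (E : 'I_n -> normedModType K) (F : normedModType K).
Implicit Types (A : mlin E K^o) (y : F).

(* This is the operator written A \otimes y. *)
Definition tensor_fun A y : prod_topology E -> F := fun x => A x *: y.

Lemma tensor_is_mlin A y : tensor_fun A y \in @is_mlin K n E F.
Proof.
apply/asboolP; split=> [i x a u v|x].
  by rewrite /tensor_fun (@mlin_multilinear _ _ _ _ A) scalerDl -scalerA.
have FF := nbhs_filter x.
by apply: cvgZl; exact: mlin_continuous.
Qed.

Definition tensor A y : mlin E F := Mlin (tensor_is_mlin A y).

Lemma finite_rank_tensor A y : finite_rank (tensor A y).
Proof.
have [Ay0|] := pselect (forall x, A x *: y = 0).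
  exists 0%N, (fun=> 0); apply/seteqP; split=> v [m [c [a [aP ->]]]].
    exists 0%N, (fun=> 0), (fun=> 0); split=> [[]//|].
    rewrite big_ord0 big1// => i _.
    by have [x _ <-] := aP i; rewrite /= /tensor_fun Ay0 scaler0.
  exists 0%N, (fun=> 0), (fun=> 0); split=> [[]//|].
  by rewrite big_ord0 big1// => i _; have [[]] := aP i.
move=> /existsNP[x0 /eqP]; rewrite scaler_eq0 negb_or => /andP[Ax0 y0].
have memy z : span_set (range (tensor A y)) (z *: y).
  exists 1%N, (fun=> z / A x0), (fun=> tensor A y x0); split=> [_|]; first by exists x0.
  by rewrite big_ord1 /= /tensor_fun scalerA divfK.
exists 1%N, (fun=> y); apply/seteqP; split=> v [m [c [a [aP ->]]]].
  have /choice[b bP] : forall i, exists z, a i = A z *: y.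
    by move=> i; have [z _ <-] := aP i; exists z.
  exists 1%N, (fun=> \sum_i c i * A (b i)), (fun=> y); split=> [_|]; first by exists ord0.
  by rewrite big_ord1 scaler_suml; apply: eq_bigr => i _; rewrite bP scalerA.
rewrite (_ : \sum_i _ = (\sum_i c i) *: y)//.
by rewrite scaler_suml; apply: eq_bigr => i _; have [_ _ <-] := aP i.
Qed.

End tensor.

(* A subspace `P` of `V` endowed with a complete norm of its own, which need
   not be related to any norm on `V`. *)
#[short(type="banachSubType")]
HB.structure Definition BanachSub (K : numFieldType) (V : lmodType K)
    (P : pred V) :=
  {U of @GRing.SubLmodule K V P U & CompleteNormedModule K U}.

Definition tensor_in (K : numFieldType) (n : nat)
    (E : 'I_n -> normedModType K) (F : normedModType K)
    (P : pred (mlin E F)) (H : banachSubType P)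
    (finP : forall T : mlin E F, finite_rank T -> P T)
    (A : mlin E K^o) (y : F) : H :=
  Sub (tensor A y) (finP _ (finite_rank_tensor A y)).

(* Main.v *)
(* Writing B for the transform, B phi = 0 means that phi vanishes on all tensors.
   A finite rank operator T is a finite sum of tensors: by Hahn-Banach there are
   continuous functionals g_j and vectors y_j such that sum_j g_j(y) y_j = y on
   the range of T, so T = sum_j (g_j o T) (x) y_j.  Hence ker B is the
   annihilator of the subspace of finite rank operators, which by Hahn-Banach is
   trivial exactly when that subspace is dense.  Hahn-Banach is obtained over R
   from a Mazur-Orlicz theorem, whose functional is a minimal sublinear one. *)

From HB Require Import structures.
Require Import Defs.
From mathcomp Require Import all_boot all_order all_algebra.
From mathcomp Require Import all_classical all_reals all_analysis.
From mathcomp Require Import complex ring lra.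
Import Order.TTheory GRing.Theory Num.Theory numFieldNormedType.Exports.
Local Open Scope classical_set_scope.
Local Open Scope ring_scope.

(** * Linear subspaces as predicates on vectors *)

Section linear_subspace.
Context {L : nzRingType} {X : lmodType L}.
Implicit Types W : set X.

Definition linear_subspace W :=
  W 0 /\ forall a u v, W u -> W v -> W (a *: u + v).

Lemma subspaceZ {W} a v : linear_subspace W -> W v -> W (a *: v).
Proof. by move=> [W0 WZD] Wv; rewrite -[_ *: _]addr0; exact: WZD. Qed.

Lemma subspaceD {W} u v : linear_subspace W -> W u -> W v -> W (u + v).
Proof. by move=> [_ WZD] Wu Wv; rewrite -[u]scale1r; exact: WZD. Qed.

Lemma subspace_sum {W} (I : Type) (r : seq I) (f : I -> X) :
  linear_subspace W -> (forall i, W (f i)) -> W (\sum_(i <- r) f i).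
Proof.
move=> sW Wf; elim/big_ind : _ => [|u v|i _]; first exact: sW.1.
  exact: subspaceD.
exact: Wf.
Qed.

End linear_subspace.

(** * Hahn-Banach separation over R and C *)

Section mazur_orlicz.
Context {R : realType} {L : nzRingType} (iota : {rmorphism R -> L}).
Context {X : lmodType L}.
Implicit Types (p q : X -> R) (C : set (X * R)).

(** The map [iota] embeds the reals into the scalars, so that complex spaces are covered as well.
    Homogeneity is only an inequality for [t > 0], a form that passes easily to infima; [sublinearZ]
    recovers the equality. *)
Definition sublinear q :=
  (forall x y, q (x + y) <= q x + q y) /\
  (forall t x, 0 < t -> q (iota t *: x) <= t * q x).

(** A pair [(x, r)] of the cone encodes the constraint [r <= u x] on the functional [u] to be
    found. *)
Definition cone_below q C :=
  [/\ C (0, 0),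
      forall c d, C c -> C d -> C (c.1 + d.1, c.2 + d.2),
      forall t c, 0 < t -> C c -> C (iota t *: c.1, t * c.2)
    & forall c, C c -> c.2 <= q c.1].

Lemma sublinear0 {q} : sublinear q -> q 0 = 0.
Proof.
move=> [_ qZ]; apply/le_anti/andP; split.
  have := qZ (1 / 2) 0; rewrite scaler0 => /(_ ltac:(lra)); lra.
have := qZ 2 0; rewrite scaler0 => /(_ ltac:(lra)); lra.
Qed.

Lemma sublinearZ {q} t x : sublinear q -> 0 <= t -> q (iota t *: x) = t * q x.
Proof.
move=> sq; rewrite le_eqVlt => /predU1P[<-|t0].
  by rewrite rmorph0 scale0r (sublinear0 sq) mul0r.
apply/le_anti; rewrite sq.2//=.
have := sq.2 t^-1 (iota t *: x); rewrite invr_gt0 => /(_ t0).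
by rewrite scalerA -rmorphM mulVf ?gt_eqF// rmorph1 scale1r ler_pdivlMl.
Qed.

Lemma sublinear_ge {q} x y : sublinear q -> q y - q (- x) <= q (x + y).
Proof.
by move=> [qD _]; have := qD (x + y) (- x); rewrite addrAC subrr add0r; lra.
Qed.

(** The witness is the infimum of [q (x + c.1) - c.2] over the cone. It is finite because
    [c.2 <= q c.1] bounds these values below by [- q (- x)]. The choice [c = (0, 0)] gives
    [q' <= q], and evaluation at [- c.1] gives the last bound. *)
Lemma sublinear_below_cone q C : sublinear q -> cone_below q C ->
  exists q', [/\ sublinear q', forall x, q' x <= q x
               & forall c, C c -> q' (- c.1) <= - c.2].
Proof.
move=> sq [C0 CD CZ Cq].
pose S x := [set q (x + c.1) - c.2 | c in C].
have S0 x : S x !=set0 by exists (q (x + 0) - 0), (0, 0).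
have lbS x : has_lbound (S x).
  exists (- q (- x)) => _ [c Cc <-].
  by have := sublinear_ge x c.1 sq; have := Cq _ Cc; lra.
have le_infS x c : C c -> inf (S x) <= q (x + c.1) - c.2.
  by move=> Cc; apply: ge_inf => //; exists c.
have infSD x y : inf (S (x + y)) <= inf (S x) + inf (S y).
  rewrite -lerBlDr; apply: lb_le_inf => // _ [c Cc <-].
  rewrite lerBlDr -lerBlDl; apply: lb_le_inf => // _ [d Cd <-].
  have /= := le_infS (x + y) _ (CD _ _ Cc Cd).
  by rewrite addrACA; have := sq.1 (x + c.1) (y + d.1); lra.
exists (fun x => inf (S x)); split=> [|x|c Cc].
- split=> // t x t0; rewrite -ler_pdivrMl//; apply: lb_le_inf => // _ [c Cc <-].
  rewrite ler_pdivrMl// (le_trans (le_infS _ _ (CZ _ _ t0 Cc)))//=.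
  by rewrite -scalerDr (sublinearZ _ _ sq) ?(ltW t0)// mulrBr.
- by have := le_infS x _ C0; rewrite /= addr0 subr0.
- by have := le_infS (- c.1) _ Cc; rewrite addNr (sublinear0 sq) sub0r.
Qed.

(** Zorn's lemma for the reversed pointwise order: a nonempty chain is bounded by its pointwise
    infimum, which is finite since every member is at least [- p (- x)] at [x]. *)
Lemma minimal_sublinear p : sublinear p ->
  exists q, [/\ sublinear q, forall x, q x <= p x
    & forall q', sublinear q' -> (forall x, q' x <= q x) -> q' = q].
Proof.
move=> sp; pose T := {q | sublinear q /\ forall x, q x <= p x}.
pose ge (q q' : T) := `[< forall x, sval q' x <= sval q x >].
pose p0 : T := exist _ p (conj sp (fun=> lexx _)).
have [|a b c /asboolP ab /asboolP bc|A totA|[q [sq qp]] qmin] :=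
  ZL_preorder p0 (R := ge).
- by move=> a; exact/asboolP.
- by apply/asboolP => x; exact: le_trans (bc x) (ab x).
- have [[a0 Aa0]|A0] := pselect (A !=set0); last first.
    by exists p0 => s As; exfalso; apply: A0; exists s.
  pose S x := [set sval a x | a in A].
  have S0 x : S x !=set0 by exists (sval a0 x), a0.
  have lbS x : has_lbound (S x).
    exists (- p (- x)) => _ [[a [sa ap]] Aa <-] /=.
    have := sublinear_ge x 0 sa; rewrite addr0 (sublinear0 sa).
    by have := ap (- x); lra.
  have le_infS x a : A a -> inf (S x) <= sval a x.
    by move=> Aa; apply: ge_inf => //; exists a.
  (* Totality of the chain enters here: the smaller of [a] and [b] is at most [a x] at [x] and at
     most [b y] at [y], and its own subadditivity concludes. *)
  have infSD x y : inf (S (x + y)) <= inf (S x) + inf (S y).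
    rewrite -lerBlDr; apply: lb_le_inf => // _ [a Aa <-].
    rewrite lerBlDr -lerBlDl; apply: lb_le_inf => // _ [b Ab <-].
    have aD := (svalP a).1.1 x y; have bD := (svalP b).1.1 x y.
    have := le_infS (x + y) a Aa; have := le_infS (x + y) b Ab.
    by have [/asboolP/(_ x)|/asboolP/(_ y)] := totA _ _ Aa Ab; lra.
  have sinf : sublinear (fun x => inf (S x)).
    split=> // t x t0; rewrite -ler_pdivrMl//; apply: lb_le_inf => // _ [a Aa <-].
    rewrite ler_pdivrMl// (le_trans (le_infS _ _ Aa))//.
    exact: (svalP a).1.2.
  have infp x : inf (S x) <= p x.
    exact: le_trans (le_infS _ _ Aa0) ((svalP a0).2 x).
  exists (exist _ (fun x => inf (S x)) (conj sinf infp)) => a Aa.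
  apply/asboolP => x; exact: le_infS.
- exists q; split=> // q' sq' q'q; apply/funext => x.
  have q'p y : q' y <= p y by exact: le_trans (q'q y) (qp y).
  apply/le_anti; rewrite q'q /=.
  by have /asboolP := qmin (exist _ q' (conj sq' q'p)) (asboolT q'q); apply.
Qed.

(* A minimal sublinear functional cannot be pushed down along the ray spanned by
   [(y, q y)], so [q (- y) <= - q y]. *)
Lemma minimal_sublinearD q : sublinear q ->
  (forall q', sublinear q' -> (forall x, q' x <= q x) -> q' = q) ->
  {morph q : x y / x + y}.
Proof.
move=> sq qmin.
have qN y : q (- y) <= - q y.
  pose C := [set (iota t *: y, t * q y) | t in [set t : R | 0 <= t]].
  have coneC : cone_below q C.
    split.
    - by exists 0 => //=; rewrite rmorph0 scale0r mul0r.
    - move=> _ _ [s /= s0 <-] [t /= t0 <-]; exists (s + t); first exact: addr_ge0.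
      by rewrite rmorphD scalerDl mulrDl.
    - move=> t _ t0 [s /= s0 <-]; exists (t * s) => /=.
        by rewrite mulr_ge0// ltW.
      by rewrite rmorphM scalerA mulrA.
    - by move=> _ [t t0 <-] /=; rewrite (sublinearZ _ _ sq).
  have [q' [sq' q'q q'C]] := sublinear_below_cone _ _ sq coneC.
  have := q'C (y, q y); rewrite (qmin _ sq' q'q); apply.
  by exists 1 => /=; rewrite ?ler01// rmorph1 scale1r mul1r.
(* The reverse inequality is [q x <= q (x + y) + q (- y) <= q (x + y) - q y]. *)
move=> x y; apply/le_anti; rewrite sq.1 /=.
by have := sq.1 (x + y) (- y); rewrite addrK; have := qN y; lra.
Qed.

(** First [p] is lowered along the cone to [q], then [u] is a minimal sublinear functional below
    [q]. Since [u] is additive it is odd, which turns [u (- c.1) <= - c.2] into the constraint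
    encoded by [c]. *)
Theorem mazur_orlicz p C : sublinear p -> cone_below p C ->
  exists u, [/\ {morph u : x y / x + y}, forall t x, u (iota t *: x) = t * u x,
    forall x, u x <= p x & forall c, C c -> c.2 <= u c.1].
Proof.
move=> sp /(sublinear_below_cone _ _ sp)[q [sq qp qC]].
have [u [su uq umin]] := minimal_sublinear _ sq.
have uD := minimal_sublinearD _ su umin.
have uN x : u (- x) = - u x.
  by apply/eqP; rewrite -addr_eq0 -uD addNr (sublinear0 su).
exists u; split=> // [t x|x|c Cc].
- have [t0|/ltW t0] := leP 0 t; first exact: sublinearZ.
  rewrite -[t]opprK rmorphN scaleNr uN (sublinearZ (- t) x su) ?mulNr ?opprK//.
  by rewrite oppr_ge0.
- exact: le_trans (uq x) (qp x).
- by rewrite -lerN2 -uN (le_trans (uq _))// qC.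
Qed.

End mazur_orlicz.

(** Mazur-Orlicz is applied to the cone generated by the pairs [(v, 0)] with [v] in [V] and by
    [(x0, d)]. The constraints at [v] and [- v] force [u v = 0], and the one at [(x0, d)] gives
    [d <= u x0]. *)
Lemma separating_additive (R : realType) (L : nzRingType)
    (iota : {rmorphism R -> L}) (X : lmodType L) (N : X -> R) (V : set X)
    (x0 : X) (d : R) :
  (forall x y, N (x + y) <= N x + N y) ->
  (forall t x, 0 <= t -> N (iota t *: x) = t * N x) ->
  (forall x, 0 <= N x) ->
  linear_subspace V ->
  0 < d -> (forall v, V v -> d <= N (x0 + v)) ->
  exists u, [/\ {morph u : x y / x + y}, forall t x, u (iota t *: x) = t * u x,
    forall x, u x <= N x, forall v, V v -> u v = 0 & 0 < u x0].
Proof.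
move=> ND NZ N0 sV d0 dN.
have VZ a v : V v -> V (a *: v) by exact: subspaceZ.
have VD v w : V v -> V w -> V (v + w) by exact: subspaceD.
pose C := [set c : X * R | exists v t,
  [/\ V v, 0 <= t & c = (v + iota t *: x0, t * d)]].
have CV v : V v -> C (v, 0).
  by move=> Vv; exists v, 0; rewrite rmorph0 scale0r addr0 mul0r.
have sN : sublinear iota N by split=> // t x /ltW t0; rewrite NZ.
have coneC : cone_below iota N C.
  split.
  - by apply: CV; exact: sV.1.
  - move=> _ _ [v [s [Vv s0 ->]]] [w [t [Vw t0 ->]]].
    exists (v + w), (s + t); split; [exact: VD|exact: addr_ge0|].
    by rewrite /= rmorphD scalerDl addrACA mulrDl.
  - move=> t _ t0 [v [s [Vv s0 ->]]]; exists (iota t *: v), (t * s).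
    split; [exact: VZ|by rewrite mulr_ge0// ltW|].
    by rewrite /= scalerDr rmorphM scalerA mulrA.
  - move=> _ [v [t [Vv t0 ->]]] /=.
    (* For [t = 0] only nonnegativity of [N] is at stake; otherwise [t] is factored out of [N],
       which leaves the distance bound at [iota t^-1 *: v]. *)
    have [->|tn0] := eqVneq t 0.
      by rewrite mul0r.
    have -> : v + iota t *: x0 = iota t *: (x0 + iota t^-1 *: v).
      by rewrite scalerDr scalerA -rmorphM divff// rmorph1 scale1r addrC.
    by rewrite NZ// ler_wpM2l// dN//; exact: VZ.
have [u [uD uZ uN uC]] := mazur_orlicz _ _ _ sN coneC.
exists u; split=> // [v Vv|].
  have u0 : u 0 = 0 by have := uZ 0 0; rewrite rmorph0 scaler0 mul0r.
  have := uC _ (CV _ Vv); have := uC _ (CV _ (VZ (-1) _ Vv)).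
  rewrite /= scaleN1r; have := uD v (- v); rewrite subrr u0; lra.
have : C (x0, d).
  exists 0, 1; rewrite ler01 rmorph1 scale1r add0r mul1r.
  by split=> //; exact: sV.1.
by move=> /uC /=; exact: lt_le_trans.
Qed.

Lemma is_clin_bounded (K : numFieldType) (X Y : normedModType K) (f : X -> Y)
    (M : K) :
  0 <= M -> linear f -> (forall x, `|f x| <= M * `|x|) -> f \in @is_clin K X Y.
Proof.
move=> M0 fl fM; apply/asboolP; split=> //.
pose g : {linear X -> Y} := HB.pack f (GRing.isLinear.Build K X Y *:%R f fl).
have : continuous g.
  apply: bounded_linear_continuous; apply/linear_boundedP.
  near=> r; move=> x; rewrite (le_trans (fM x))// ler_wpM2r//.
  by near: r; apply: nbhs_pinfty_ge; exact: ger0_real.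
by [].
Unshelve. all: end_near.
Qed.

Definition separates {K : numFieldType} {X : normedModType K} (V : set X) x0 :=
  exists phi : dual X, (forall v, V v -> phi v = 0) /\ phi x0 != 0.

Lemma real_separation (R : realType) (X : normedModType R) (V : set X) (x0 : X)
    (d : R) :
  linear_subspace V ->
  0 < d -> (forall v, V v -> d <= `|x0 + v|) -> separates V x0.
Proof.
move=> sV d0 dV.
have [u [uD uZ uN uV ux0]] :=
  @separating_additive R R idfun X (@Num.norm _ X) V x0 d (@ler_normD _ _)
  (fun t x t0 => etrans (normrZ t x) (congr1 ( *%R^~ _) (ger0_norm t0)))
  (@normr_ge0 _ _) sV d0 dV.
have ul : linear (u : X -> R^o) by move=> a x y; rewrite uD uZ.
have uB x : `|u x : R^o| <= 1 * `|x|.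
  have := uN (- x); rewrite normrN -scaleN1r uZ => uNx.
  by rewrite mul1r ler_norml uN andbT lerNl -mulN1r.
exists (Clin (is_clin_bounded _ _ _ _ _ ler01 ul uB)); split=> //=.
by rewrite gt_eqF.
Qed.

(* A real-linear functional [u] is the real part of the complex-linear
   functional [u x - i * u (i x)]. *)
Lemma complex_separation (R : realType) (X : normedModType R[i]) (V : set X)
    (x0 : X) (d : R[i]) :
  linear_subspace V ->
  0 < d -> (forall v, V v -> d <= `|x0 + v|) -> separates V x0.
Proof.
(* The norm takes its values in [R[i]]; [N] is its real-valued form, to which the real argument
   applies. *)
move=> sV d0 dV; pose N (x : X) : R := complex.Re `|x|.
have normN x : `|x| = (N x)%:C%C :> R[i].
  rewrite /N; have := normr_ge0 x; case: `|x| => a b.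
  by rewrite lecE /= => /andP[/eqP->].
have dE : d = (complex.Re d)%:C%C.
  by case: d d0 {dV} => a b; rewrite ltcE /= => /andP[/eqP->].
have ND x y : N (x + y) <= N x + N y.
  by rewrite -lecR rmorphD /= -3!normN; exact: ler_normD.
have NZ a x : (N (a *: x))%:C%C = `|a| * (N x)%:C%C by rewrite -!normN normrZ.
have NZr t x : 0 <= t -> N (t%:C%C *: x) = t * N x.
  move=> t0; apply: (@complexI R); rewrite NZ rmorphM ger0_norm//.
  by rewrite ler0c.
have N0 x : 0 <= N x by rewrite -ler0c -normN.
have d0' : 0 < complex.Re d by move: d0; rewrite ltcE => /andP[].
have dV' v : V v -> complex.Re d <= N (x0 + v).
  by move=> Vv; rewrite -lecR -normN -dE dV.
have [u [uD uZ uN uV ux0]] :=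
  @separating_additive R R[i] (real_complex R) X N V x0 _ ND NZr N0 sV d0' dV'.
have uN' x : `|u x| <= N x.
  rewrite ler_norml uN andbT lerNl -mulN1r -uZ; apply: le_trans (uN _) _.
  by rewrite rmorphN rmorph1 -lecR NZ normrN normr1 mul1r.
have Ni x : N ('i%C *: x) = N x.
  by apply: (@complexI R); rewrite NZ normc_def /= expr0n add0r expr1n sqrtr1 mul1r.
pose phi (x : X) : (R[i] : numFieldType)^o := Complex (u x) (- u ('i%C *: x)).
have phil : linear phi.
  move=> [b c] x y.
  have aE : (b +i* c)%C = b%:C%C + 'i%C * c%:C%C by exact: complexE.
  have iaE : 'i%C * (b +i* c)%C = b%:C%C * 'i%C + (- c)%:C%C.
    by apply/eqP; rewrite eq_complex /=; apply/andP; split; apply/eqP; ring.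
  rewrite /phi scalerDr !uD scalerA iaE scalerDl -scalerA uD !uZ.
  rewrite {1}aE scalerDl uD mulrC -scalerA !uZ.
  by apply/eqP; rewrite eq_complex /=; apply/andP; split; apply/eqP; ring.
(* The constant 2 adds the bounds of [u x] and [u ('i%C *: x)], each at most [N x] in absolute
   value; this is enough for continuity. *)
have phiB x : `|phi x| <= 2 * `|x|.
  have -> : phi x = (u x)%:C%C - 'i%C * (u ('i%C *: x))%:C%C.
    by apply/eqP; rewrite eq_complex /=; apply/andP; split; apply/eqP; ring.
  have normr r : `|r%:C%C| = `|r|%:C%C :> R[i].
    by rewrite normc_def /= expr0n addr0 sqrtr_sqr.
  rewrite (le_trans (ler_normB _ _))// normrM !normr normc_def /=.
  rewrite expr0n add0r expr1n sqrtr1 mul1r mulr_natl mulr2n normN lerD ?lecR//.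
  by rewrite -Ni uN'.
exists (Clin (is_clin_bounded _ _ _ _ _ (ler0n _ 2) phil phiB)); split=> [v Vv|] /=.
  (* As [V] is a complex subspace, [u] vanishes at ['i%C *: v] too, so both parts of [phi v] are
     zero. *)
  have Vi : V ('i%C *: v) by exact: subspaceZ.
  by rewrite /phi (uV _ Vv) (uV _ Vi) oppr0.
by rewrite eq_complex /= negb_and gt_eqF.
Qed.

Lemma separation (R : realType) k (X : normedModType (scalar_field R k)) (V : set X)
    (x0 : X) (d : scalar_field R k) :
  linear_subspace V ->
  0 < d -> (forall v, V v -> d <= `|x0 + v|) -> separates V x0.
Proof.
case: k X V x0 d => X V x0 d; [exact: real_separation|exact: complex_separation].
Qed.

(** * Finite rank operators *)

Section lspan.
Context {K : fieldType} {V : lmodType K}.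
Implicit Types (W : set V) (s : seq V).

(** The recursive form removes one generator at a time, which suits induction on the list. *)
Fixpoint lspan s : set V :=
  if s is y :: s' then [set x | exists a, lspan s' (x - a *: y)] else [set 0].

Lemma lspan_subspace s : linear_subspace (lspan s).
Proof.
elim: s => [|y s [s0 sZD]]; split=> //=.
- by move=> a u v -> ->; rewrite scaler0 addr0.
- by exists 0; rewrite scale0r subr0.
- move=> a u v [b us] [c vs]; exists (a * b + c); have := sZD a _ _ us vs.
  by rewrite scalerBr scalerDl -scalerA opprD addrACA.
Qed.

Lemma lspan_mem s y : y \in s -> lspan s y.
Proof.
elim: s => //= z s IHs; rewrite in_cons => /predU1P[->|ys].
  by exists 1; rewrite scale1r subrr; exact: (lspan_subspace s).1.
by exists 0; rewrite scale0r subr0; exact: IHs.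
Qed.

Lemma lspan_min s W :
  linear_subspace W -> (forall y, y \in s -> W y) -> lspan s `<=` W.
Proof.
move=> sW; elim: s => [_ x /= ->|y s IHs sub x [a xs]]; first exact: sW.1.
rewrite -[x](subrK (a *: y)); apply: subspaceD => //.
  by apply: IHs xs => z zs; apply: sub; rewrite in_cons zs orbT.
by apply: subspaceZ => //; apply: sub; rewrite mem_head.
Qed.

Lemma lspan_catl s s' : lspan s `<=` lspan (s ++ s').
Proof.
apply: lspan_min; first exact: lspan_subspace.
by move=> y ys; apply: lspan_mem; rewrite mem_cat ys.
Qed.

Lemma lspan_catr s s' : lspan s' `<=` lspan (s ++ s').
Proof.
apply: lspan_min; first exact: lspan_subspace.
by move=> y ys; apply: lspan_mem; rewrite mem_cat ys orbT.
Qed.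

(** Induction on [s]: generators of the intersection of [W] with [lspan s] suffice, together with at
    most one vector [w] of [W] outside [lspan s], whose coefficient [b] along [y] is then
    nonzero. *)
Lemma subspace_of_lspan W s : linear_subspace W -> W `<=` lspan s ->
  exists s', W = lspan s'.
Proof.
elim: s W => [W [W0 _] Ws|y s IHs W sW Ws].
  by exists [::]; apply/seteqP; split=> // x /= ->.
have sWs : linear_subspace (W `&` lspan s).
  split=> [|a u v [Wu su] [Wv sv]].
    by split; [exact: sW.1|exact: (lspan_subspace s).1].
  by split; [exact: sW.2|exact: (lspan_subspace s).2].
have [s' s'E] := IHs _ sWs (@subIsetr _ _ _).
have [Wsub|/existsNP[w /not_implyP[Ww nsw]]] := pselect (W `<=` lspan s).
  exists s'; rewrite -s'E; apply/seteqP; split=> [x Wx|x []//].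
  by split=> //; exact: Wsub.
have [b wb] := Ws _ Ww.
have b0 : b != 0.
  by apply/eqP => b0; apply: nsw; move: wb; rewrite b0 scale0r subr0.
exists (w :: s'); apply/seteqP; split=> [x Wx|].
  (* Subtracting [(a / b) *: w] cancels the component of [x] along [y]. *)
  have [a xa] := Ws _ Wx; exists (a / b); rewrite -s'E -scaleNr addrC; split.
    exact: sW.2.
  have -> : - (a / b) *: w + x = - (a / b) *: (w - b *: y) + (x - a *: y).
    rewrite scalerBr scalerA mulNr divfK//.
    by rewrite [- a *: y]scaleNr opprK addrACA subrr addr0.
  exact: (lspan_subspace s).2.
apply: lspan_min => // z; rewrite in_cons => /predU1P[->//|zs'].
by have : lspan s' z by [exact: lspan_mem]; rewrite -s'E => -[].
Qed.

End lspan.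

(** * Spans of sets and finite dimension *)

Section span_set.
Context {K : numFieldType} {V : lmodType K}.
Implicit Types (A W : set V).

Lemma sub_span_set A : A `<=` span_set A.
Proof.
move=> x Ax; exists 1%N, (fun=> 1), (fun=> x); split=> //.
by rewrite big_ord1 scale1r.
Qed.

Lemma span_set_subspace A : linear_subspace (span_set A).
Proof.
split=> [|a u v [m [c [x [Ax ->]]]] [m' [c' [x' [Ax' ->]]]]].
  by exists 0%N, (fun=> 0), (fun=> 0); split=> [[]//|]; rewrite big_ord0.
exists (m + m')%N,
  (fun i => match fintype.split i with inl j => a * c j | inr j => c' j end),
  (fun i => match fintype.split i with inl j => x j | inr j => x' j end).
split=> [i|]; first by case: fintype.split.
rewrite big_split_ord /= scaler_sumr; congr +%R; apply: eq_bigr => i _.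
  by rewrite (unsplitK (inl i)) scalerA.
by rewrite (unsplitK (inr i)).
Qed.

Lemma span_set_min A W : linear_subspace W -> A `<=` W -> span_set A `<=` W.
Proof.
move=> sW AW _ [m [c [x [Ax ->]]]]; apply: subspace_sum => // i.
by apply: subspaceZ => //; exact: AW.
Qed.

(** This replaces an exact finite generating family by a mere inclusion, which is easier to check;
    [subspace_of_lspan] bridges the gap. *)
Lemma finite_dim_setP A :
  finite_dim_set (span_set A) <-> exists s, A `<=` lspan s.
Proof.
split=> [[m [b spanA]]|[s As]].
  exists (codom b); apply: subset_trans (@sub_span_set A) _; rewrite spanA.
  apply: span_set_min; first exact: lspan_subspace.
  by move=> _ [i _ <-]; apply: lspan_mem; exact: codom_f.
have [s' ->] := subspace_of_lspan _ _ (span_set_subspace A)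
  (span_set_min _ _ (lspan_subspace s) As).
exists (size s'), (fun i => s'`_i); apply/seteqP; split.
  apply: lspan_min; first exact: span_set_subspace.
  move=> y /[dup] ys; rewrite -index_mem => lt_y; apply: sub_span_set.
  by exists (Ordinal lt_y) => //=; rewrite nth_index.
apply: span_set_min; first exact: lspan_subspace.
by move=> _ [i _ <-]; apply: lspan_mem; exact: mem_nth.
Qed.

End span_set.

Lemma clin_sumE (K : numFieldType) (X Y : normedModType K) (I : Type) (r : seq I)
    (f : I -> clin X Y) x : (\sum_(i <- r) f i) x = \sum_(i <- r) f i x.
Proof. by elim/big_rec2 : _ => // i y g _ <-. Qed.

Lemma mlin_sumE (K : numFieldType) n (E : 'I_n -> normedModType K)
    (F : normedModType K) (I : Type) (r : seq I) (f : I -> mlin E F) x :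
  (\sum_(i <- r) f i) x = \sum_(i <- r) f i x.
Proof. by elim/big_rec2 : _ => // i y g _ <-. Qed.

Lemma clin_comp_mlin (K : numFieldType) n (E : 'I_n -> normedModType K)
    (F G : normedModType K) (g : clin F G) (T : mlin E F) :
  g \o T \in @is_mlin K n E G.
Proof.
have /asboolP[gl gc] := clinP g.
apply/asboolP; split=> [i x a u v|x] /=.
  by rewrite (@mlin_multilinear _ _ _ _ T) gl.
apply: continuous_comp; [exact: mlin_continuous|exact: gc].
Qed.

(** * Decomposition of finite rank operators into tensors *)

Section finite_rank.
Context {R : realType} {k : scalars}.
Local Notation K := (scalar_field R k).
Context {n : nat} {E : 'I_n -> normedModType K} {F : normedModType K}.

(** The point [x] is separated from the zero subspace, at distance [|x|], and the functional is
    rescaled. *)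
Lemma dual_neq0 (x : F) : x != 0 -> exists g : dual F, g x = 1.
Proof.
move=> x0; have [|||g [_ gx]] := @separation R k F [set 0] x `|x|.
- by split=> // a u v -> ->; rewrite scaler0 addr0.
- by rewrite normr_gt0.
- by move=> v ->; rewrite addr0.
exists ((g x)^-1 *: g); rewrite -[LHS]/((g x)^-1 * g x).
by rewrite mulVf.
Qed.

(* The list [t] encodes a continuous finite rank operator that fixes [lspan s];
   adding one vector at a time to [s], it is enough to have functionals that do
   not vanish at a given nonzero vector. *)
Lemma lspan_expansion (s : seq F) : exists t : seq (dual F * F),
  forall x, lspan s x -> \sum_(p <- t) p.1 x *: p.2 = x.
Proof.
elim: s => [|v s [t tP]]; first by exists [::] => x /= ->; rewrite big_nil.
pose Q x := \sum_(p <- t) p.1 x *: p.2.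
have Qlin : linear Q.
  move=> a x y; rewrite /Q scaler_sumr -big_split; apply: eq_bigr => p _ /=.
  by rewrite linearP scalerDl scalerA.
have QE a x : Q x = a *: Q v + Q (x - a *: v) by rewrite -Qlin addrC subrK.
have [/eqP|w0] := eqVneq (v - Q v) 0.
  rewrite subr_eq0 => /eqP vE; exists t => x [a /tP xs].
  by rewrite -/(Q x) (QE a) -vE [Q _]xs addrC subrK.
have [g gw] := dual_neq0 _ w0.
(* This is the continuous functional [g (x - Q x)]: it vanishes on [lspan s], which [Q] fixes, and
   equals 1 at [v]. Adding the pair [(h, v - Q v)] therefore corrects [Q] at [v] without changing it
   on [lspan s]. *)
pose h : dual F := g - \sum_(p <- t) g p.2 *: p.1.
have hE x : h x = g (x - Q x).
  rewrite linearB linear_sum.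
  rewrite -[LHS]/(g x - (\sum_(p <- t) g p.2 *: p.1 : dual F) x) clin_sumE.
  congr (_ - _); apply: eq_bigr => p _; rewrite linearZ.
  by rewrite -[LHS]/(g p.2 * p.1 x) mulrC.
exists ((h, v - Q v) :: t) => x [a /tP xs].
  rewrite big_cons -[LHS]/(h x *: (v - Q v) + Q x) hE.
have Qx : Q x = a *: Q v + (x - a *: v) by rewrite (QE a) [Q (_ - _)]xs.
have -> : x - Q x = a *: (v - Q v).
  by rewrite Qx opprD opprB addrCA [x + _]addrC subrK scalerBr addrC.
have -> : g (a *: (v - Q v)) = a.
  by rewrite linearZ -[LHS]/(a * g (v - Q v)) gw mulr1.
rewrite Qx scalerBr.
by rewrite addrA subrK addrC subrK.
Qed.

Lemma finite_rankP (T : mlin E F) :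
  finite_rank T <-> exists s, forall x, lspan s (T x).
Proof.
rewrite /finite_rank finite_dim_setP; split=> -[s sP]; exists s.
  by move=> x; apply: sP; exists x.
by move=> _ [x _ <-].
Qed.

Lemma finite_rank_sum_tensor (T : mlin E F) : finite_rank T ->
  exists t : seq (mlin E K^o * F), T = \sum_(p <- t) tensor p.1 p.2.
Proof.
move=> /finite_rankP[s Ts]; have [t tP] := lspan_expansion s.
exists [seq (Mlin (@clin_comp_mlin _ _ _ _ _ p.1 T), p.2) | p <- t].
apply/val_inj/funext => x; rewrite big_map [RHS]mlin_sumE.
by rewrite -[LHS](tP _ (Ts x)).
Qed.

(** Concatenating lists that span the two ranges gives a list whose span contains the range of any
    combination. *)
Lemma finite_rank_subspace : linear_subspace (@finite_rank K n E F).
Proof.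
split=> [|a T U T_fin U_fin]; first by apply/(finite_rankP 0); exists [::].
have [s Ts] := (finite_rankP T).1 T_fin.
have [t Ut] := (finite_rankP U).1 U_fin.
apply/(finite_rankP (a *: T + U)); exists (s ++ t) => x.
apply: (lspan_subspace (s ++ t)).2.
  exact/lspan_catl/Ts.
exact/lspan_catr/Ut.
Qed.

End finite_rank.

(** * Operator norm estimates *)

Lemma clin_le (R : realType) k (X Y : normedModType (scalar_field R k))
    (f : clin X Y) x :
  `|f x| <= `|f| * `|x|.
Proof.
have [->|x0] := eqVneq x 0; first by rewrite linear0 !normr0 mulr0.
rewrite -ler_pdivrMr ?normr_gt0// mulrC.
have -> : `|x|^-1 * `|f x| = `|f (`|x|^-1 *: x)|.
  by rewrite linearZ normrZ normfV normr_id.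
apply: opnorm_ub; first by exists 0; rewrite /= normr0.
  exact: clin_bounded.
by rewrite /= normfZV.
Qed.

Lemma clin_norm_le (R : realType) k (X Y : normedModType (scalar_field R k))
    (f : clin X Y) M : 0 <= M -> (forall x, `|f x| <= M * `|x|) -> `|f| <= M.
Proof.
move=> M0 fM; apply: opnorm_le => [||x /= x1]; first by exists 0; rewrite /= normr0.
  exact: clin_bounded.
by rewrite (le_trans (fM x))// ler_piMr.
Qed.

(** * Tensors as elements of [H] *)

Section tensor_in.
Context {R : realType} {k : scalars}.
Local Notation K := (scalar_field R k).
Context {n : nat} {E : 'I_n -> normedModType K} {F : normedModType K}.
Context {P : pred (mlin E F)} (H : banachSubType P)
  (finP : forall T : mlin E F, finite_rank T -> P T).
Local Notation tensorH := (tensor_in H finP).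

Lemma tensor_in_linearl y : linear (tensorH ^~ y).
Proof.
move=> a A B; apply/val_inj; rewrite linearP /= !SubK; apply/val_inj/funext => x.
by rewrite -[LHS]/((a * A x + B x) *: y) scalerDl -scalerA.
Qed.

Lemma tensor_in_linearr A : linear (tensorH A).
Proof.
move=> a y z; apply/val_inj; rewrite linearP /= !SubK; apply/val_inj/funext => x.
by rewrite -[LHS]/(A x *: (a *: y + z)) scalerDr scalerA mulrC -scalerA.
Qed.

(** The decomposition into tensors holds in [mlin E F]; injectivity of [\val] lifts it to [H], where
    linearity applies. *)
Lemma eq_on_finite_rank (Y : normedModType K) (phi psi : clin H Y) :
  (forall A y, phi (tensorH A y) = psi (tensorH A y)) ->
  forall h, finite_rank (\val h) -> phi h = psi h.
Proof.
move=> phipsi h /finite_rank_sum_tensor[t hE].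
have -> : h = \sum_(p <- t) tensorH p.1 p.2.
  apply/val_inj; rewrite hE linear_sum; apply: eq_bigr => p _.
  by rewrite /= SubK.
by rewrite !linear_sum; apply: eq_bigr => p _; exact: phipsi.
Qed.
End tensor_in.

(** * The transform *)

Section borel_transform.
Context {R : realType} {k : scalars}.
Local Notation K := (scalar_field R k).
Context {n : nat} {E : 'I_n -> normedModType K} {F : normedModType K}.
Context {P : pred (mlin E F)} (H : banachSubType P)
  (finP : forall T : mlin E F, finite_rank T -> P T).
Local Notation tensorH := (tensor_in H finP).
Hypothesis normH : forall A y, `|tensorH A y| <= `|A| * `|y|.
Implicit Types (phi : dual H) (A : mlin E K^o).

(** Read in turn as a bound in [y], in [A] and in [phi], this one estimate yields continuity at all
    three levels of the transform. *)
Lemma borel_bound phi A y : `|phi (tensorH A y)| <= `|phi| * `|A| * `|y|.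
Proof. by rewrite (le_trans (clin_le _ _ _ _ _ _))// -mulrA ler_wpM2l. Qed.

Lemma borel_arg_is_clin phi A : (fun y => phi (tensorH A y)) \in @is_clin K F K^o.
Proof.
apply: is_clin_bounded (borel_bound phi A); first exact: mulr_ge0.
by move=> a y z; rewrite tensor_in_linearr linearP.
Qed.

Definition borel_arg phi A : dual F := Clin (borel_arg_is_clin phi A).

Lemma borel_arg_le phi A : `|borel_arg phi A| <= `|phi| * `|A|.
Proof. by apply: clin_norm_le; [exact: mulr_ge0|exact: borel_bound]. Qed.

Lemma borel_fun_is_clin phi : borel_arg phi \in @is_clin K (mlin E K^o) (dual F).
Proof.
apply: is_clin_bounded (borel_arg_le phi) => // a A B.
apply/val_inj/funext => y.
rewrite -[LHS]/(phi (tensorH (a *: A + B) y)) (tensor_in_linearl _ _ y) linearP.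
by [].
Qed.

Definition borel_fun phi : clin (mlin E K^o) (dual F) :=
  Clin (borel_fun_is_clin phi).

(** The factor 1 is kept explicit to match the bounds expected by [is_clin_bounded] and
    [clin_norm_le]. *)
Lemma borel_fun_le phi : `|borel_fun phi| <= 1 * `|phi|.
Proof. by rewrite mul1r; apply: clin_norm_le => // A; exact: borel_arg_le. Qed.

Lemma borel_transform_is_clin :
  borel_fun \in @is_clin K (dual H) (clin (mlin E K^o) (dual F)).
Proof.
apply: is_clin_bounded borel_fun_le => // a phi psi.
by apply/val_inj/funext => A; apply/val_inj/funext => y.
Qed.

Definition borel_transform : clin (dual H) (clin (mlin E K^o) (dual F)) :=
  Clin borel_transform_is_clin.

Lemma borel_transformE phi A y : borel_transform phi A y = phi (tensorH A y).
Proof. by []. Qed.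

Lemma borel_transform_norm_le1 : `|borel_transform| <= 1.
Proof. by apply: clin_norm_le; [exact: ler01|exact: borel_fun_le]. Qed.

(** If two functionals with the same transform differed at some [h], the open set where their
    difference is nonzero would meet the finite rank operators, on which they agree. *)
Lemma dense_borel_transform_injective :
  dense [set h : H | finite_rank (\val h)] -> injective borel_transform.
Proof.
move=> dfin phi psi eqB.
have eq_tensor A y : phi (tensorH A y) = psi (tensorH A y).
  by rewrite -!borel_transformE eqB.
apply/val_inj/funext => h; apply/eqP; rewrite -subr_eq0.
apply: contrapT => /negP h0.
pose chi : dual H := phi - psi.
have chi_open : open (chi @^-1` [set~ 0]).
  apply: open_comp => [x _|]; first exact: clin_continuous.
  apply: closed_openC; apply: accessible_closed_set1.
  by apply: hausdorff_accessible; exact: norm_hausdorff.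
have [|g [/= gO gfin]] := dfin _ _ chi_open.
  by exists h => /=; apply/eqP.
apply: gO; rewrite -[LHS]/(phi g - psi g).
by rewrite (eq_on_finite_rank _ _ _ _ _ eq_tensor _ gfin) subrr.
Qed.

(** A nonempty open set free of finite rank operators contains a ball around some [h], so [h] lies
    at positive distance from their subspace. Separation gives a functional that is nonzero at [h]
    but has zero transform, against injectivity. *)
Lemma borel_transform_injective_dense :
  injective borel_transform -> dense [set h : H | finite_rank (\val h)].
Proof.
move=> injB O [h Oh] Oop; apply: contrapT => noO.
pose V := [set h : H | finite_rank (\val h)].
have sV : linear_subspace V.
  split; rewrite /V/=.
    by rewrite linear0; exact: finite_rank_subspace.1.
  by move=> a u v Vu Vv /=; rewrite linearP; exact: finite_rank_subspace.2.
have /nbhs_normP[d /= d0 dO] : nbhs h O by exact: open_nbhs_nbhs.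
have [v Vv|phi [phiV]] := separation _ _ _ V h _ sV d0.
  rewrite real_leNgt ?ger0_real ?(ltW d0)//; apply/negP => hv; apply: noO.
  (* The sign comes from reading [h + v] as the difference of [h] and [- v]. *)
  exists (- v); split; first by apply: dO; rewrite /= opprK.
  by rewrite -scaleN1r; exact: subspaceZ.
have -> : phi = 0.
  apply: injB; apply/val_inj/funext => A; apply/val_inj/funext => y.
  rewrite [LHS]borel_transformE [RHS]borel_transformE phiV//.
  by rewrite /V /= SubK; exact: finite_rank_tensor.
by rewrite eqxx.
Qed.

End borel_transform.

Theorem proposition2p1 (R : realType) (k : scalars) (n : nat)
    (E : 'I_n -> completeNormedModType (scalar_field R k))
    (F : completeNormedModType (scalar_field R k))
    (P : pred (mlin E F)) (H : banachSubType P)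
    (finP : forall T : mlin E F, finite_rank T -> P T)
    (normH : forall (A : mlin E (scalar_field R k)^o) (y : F),
       `|tensor_in H finP A y| <= `|A| * `|y|) :
  exists B : clin (dual H) (clin (mlin E (scalar_field R k)^o) (dual F)),
    [/\ forall (phi : dual H) A y, B phi A y = phi (tensor_in H finP A y),
        `|B| <= 1
      & injective B <-> dense [set h : H | finite_rank (\val h)]].
Proof.
exists (borel_transform _ _ normH); split=> //.
  exact: borel_transform_norm_le1.
split; first exact: borel_transform_injective_dense.
exact: dense_borel_transform_injective.
Qed.
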